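(* Let $f\colon \mathbb{N}\to\mathbb{N}$ be a function, let $k\geq 1$, and let $G_1,\ldots,G_k$ be groups in the class $\mathcal{C}(f)$. Then the free product $G_1\ast\cdots\ast G_k$ belongs to $\mathcal{C}(g)$, where $g(n)=n f(n)$. More generally, any graph product of the groups $G_1,\ldots,G_k$ belongs to $\mathcal{C}(g)$.
   Context: Growth of actions. Let $G$ be a finitely generated group with a finite symmetric generating set $S$, and let $B_G(n)$ be the ball of radius $n$ around the identity for the word metric of $S$. For a $G$-set $X$ (not assumed transitive), put $\mathrm{vol}_{G,X}(n)=\max_{x\in X}|B_G(n)\cdot x|$. For functions $f_1,f_2$, write $f_1(n)\preccurlyeq f_2(n)$ if there is a positive integer $C$ such that $f_1(n)\le C f_2(Cn)$ for all $n\ge 1$, and $f_1\simeq f_2$ if $f_1\preccurlyeq f_2\preccurlyeq f_1$. Up to $\simeq$, $\mathrm{vol}_{G,X}$ does not depend on $S$. Class $\mathcal{C}(f)$: the class of finitely generated groups $G$ for which there exists a faithful $G$-set $X$ with $\mathrm{vol}_{G,X}(n)\preccurlyeq f(n)$. Graph product. Let $I$ be a set, and let $c$ be a map from the set of pairs $(i,j)\in I^2$ with $i\ne j$ to $\{0,1\}$ such that $c(i,j)=c(j,i)$. For a family of groups $(G_i)_{i\in I}$, the graph product associated to $c$ is the quotient of the free product of the $G_i$ by the relations $[G_i,G_j]=1$ for all $i\neq j$ with $c(i,j)=1$. Here $I=\{1,\dots,k\}$. *)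

(* Defs.v *)
From HB Require Import structures.
From mathcomp Require Import all_boot finmap boolp classical_sets cardinality.

Set Implicit Arguments.
Unset Strict Implicit.
Unset Printing Implicit Defensive.

Local Open Scope classical_set_scope.
Local Open Scope quotient_scope.
Local Open Scope group_scope.

Definition symmetric_set (G : groupType) (S : {fset G}) : Prop :=
  forall s, s \in S -> s^-1 \in S.

Definition word_ball (G : groupType) (S : {fset G}) (n : nat) : set G :=
  [set g | exists w : seq G,
     [/\ (size w <= n)%N, {subset w <= S} & g = \prod_(s <- w) s]].

(* Only used for symmetric S, so that words in S need no inverses. *)
Definition generating_set (G : groupType) (S : {fset G}) : Prop :=
  forall g : G, exists n : nat, word_ball S n g.

Record action (G : groupType) (X : Type) := Action {
  act :> G -> X -> X;
  act1 : forall x, act 1 x = x;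
  actM : forall g h x, act (g * h) x = act g (act h x) }.

Definition faithful (G : groupType) (X : Type) (a : action G X) : Prop :=
  forall g : G, (forall x, a g x = x) -> g = 1.

(* The cardinality of the finite set B_G(n) . x *)
Definition orbit_ball_card (G : groupType) (S : {fset G}) (X : Type)
    (a : action G X) (n : nat) (x : X) : nat :=
  #|` fset_set [set (a g x : {classic X}) | g in word_ball S n] |.

(* The maximum over x of |B_G(n) . x|. It exists as soon as X is nonempty, the
   cardinalities being bounded by that of the ball; it is 0 if X is empty. *)
Definition vol (G : groupType) (S : {fset G}) (X : Type)
    (a : action G X) (n : nat) : nat :=
  xget 0%N [set m | (exists x, orbit_ball_card S a n x = m) /\
                    (forall x, (orbit_ball_card S a n x <= m)%N)].

Definition growth_le (f1 f2 : nat -> nat) : Prop :=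
  exists2 C : nat, (0 < C)%N &
    forall n, (1 <= n)%N -> (f1 n <= C * f2 (C * n))%N.

Definition class_C (f : nat -> nat) (G : groupType) : Prop :=
  exists S : {fset G}, [/\ symmetric_set S, generating_set S &
    exists (X : Type) (a : action G X), faithful a /\ growth_le (vol S a) f].

Section FreeProduct.
Variables (I : choiceType) (G : I -> groupType).

Definition word := seq {i : I & G i}.

Definition letter (i : I) (g : G i) : {i : I & G i} := Tagged G g.

Inductive word_cong : word -> word -> Prop :=
| wc_refl w : word_cong w w
| wc_sym u v : word_cong u v -> word_cong v u
| wc_trans u v w : word_cong u v -> word_cong v w -> word_cong u w
| wc_cat u u' v v' :
    word_cong u u' -> word_cong v v' -> word_cong (u ++ v) (u' ++ v')
| wc_one i : word_cong [:: letter (1 : G i)] [::]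
| wc_mul i (g h : G i) : word_cong [:: letter g; letter h] [:: letter (g * h)].

Definition word_congb (u v : word) : bool := `[< word_cong u v >].

Lemma word_congb_refl : reflexive word_congb.
Proof. by move=> w; apply/asboolP; exact: wc_refl. Qed.

Lemma word_congb_sym : symmetric word_congb.
Proof. by move=> u v; apply/asboolP/asboolP; exact: wc_sym. Qed.

Lemma word_congb_trans : transitive word_congb.
Proof.
move=> v u w /asboolP uv /asboolP vw; apply/asboolP.
exact: wc_trans uv vw.
Qed.

Canonical word_equiv :=
  EquivRel word_congb word_congb_refl word_congb_sym word_congb_trans.

Definition free_product := {eq_quot word_equiv}.

HB.instance Definition _ := Choice.on free_product.

Definition fp_class (w : word) : free_product := \pi_({eq_quot word_equiv}) w.

Definition fp_repr (x : free_product) : word :=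
  repr (x : {eq_quot word_equiv}).

Lemma fp_reprK x : fp_class (fp_repr x) = x.
Proof. exact: reprK. Qed.

Lemma fp_classP u v : fp_class u = fp_class v <-> word_cong u v.
Proof.
by split=> [/eqmodP/asboolP|uv]; last by apply/eqmodP/asboolP.
Qed.

Lemma fp_repr_class w : word_cong (fp_repr (fp_class w)) w.
Proof. by apply/fp_classP; rewrite fp_reprK. Qed.

Definition word_inv (w : word) : word :=
  rev [seq let: existT i g := l in @letter i g^-1 | l <- w].

Lemma word_inv_cat u v : word_inv (u ++ v) = word_inv v ++ word_inv u.
Proof. by rewrite /word_inv map_cat rev_cat. Qed.

Lemma word_cong_inv u v : word_cong u v -> word_cong (word_inv u) (word_inv v).
Proof.
elim=> {u v} [w|u v _|u v w _ + _|u u' v v' _ uu' _ vv'|i|i g h].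
- exact: wc_refl.
- exact: wc_sym.
- exact: wc_trans.
- by rewrite !word_inv_cat; apply: wc_cat.
- by rewrite /word_inv /= /rev /= invg1; exact: wc_one.
- by rewrite /word_inv /= /rev /= invgM; exact: wc_mul.
Qed.

Lemma word_mulV w : word_cong (w ++ word_inv w) [::].
Proof.
elim: w => [|[i g] w IHw]; first exact: wc_refl.
rewrite -cat1s word_inv_cat -catA (catA w).
apply: (@wc_trans _ ([:: letter g] ++ [::] ++ [:: letter g^-1])).
  by do ![apply: wc_cat; try exact: wc_refl].
apply: wc_trans (wc_mul g g^-1) _; rewrite mulgV; exact: wc_one.
Qed.

Lemma word_mulVg w : word_cong (word_inv w ++ w) [::].
Proof.
elim: w => [|[i g] w IHw]; first exact: wc_refl.
rewrite -cat1s word_inv_cat -catA (catA _ [:: _] w).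
apply: wc_trans IHw; apply: wc_cat; first exact: wc_refl.
rewrite -[X in word_cong _ X]cat0s; apply: wc_cat; last exact: wc_refl.
apply: wc_trans (wc_mul g^-1 g) _; rewrite mulVg; exact: wc_one.
Qed.

Definition fp_one : free_product := fp_class [::].
Definition fp_mul (x y : free_product) := fp_class (fp_repr x ++ fp_repr y).
Definition fp_inv (x : free_product) := fp_class (word_inv (fp_repr x)).

Lemma fp_mulE u v : fp_mul (fp_class u) (fp_class v) = fp_class (u ++ v).
Proof. by apply/fp_classP; apply: wc_cat; exact: fp_repr_class. Qed.

Lemma fp_invE u : fp_inv (fp_class u) = fp_class (word_inv u).
Proof. by apply/fp_classP; apply: word_cong_inv; exact: fp_repr_class. Qed.

Lemma fp_mulA : associative fp_mul.
Proof.
move=> x y z; rewrite -[x]fp_reprK -[y]fp_reprK -[z]fp_reprK.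
by rewrite !fp_mulE catA.
Qed.

Lemma fp_mul1 : left_id fp_one fp_mul.
Proof. by move=> x; rewrite -[x]fp_reprK fp_mulE. Qed.

Lemma fp_mulr1 : right_id fp_one fp_mul.
Proof. by move=> x; rewrite -[x]fp_reprK fp_mulE cats0. Qed.

Lemma fp_mulV : left_inverse fp_one fp_inv fp_mul.
Proof.
move=> x; rewrite -[x]fp_reprK fp_invE fp_mulE.
by apply/fp_classP; exact: word_mulVg.
Qed.

Lemma fp_mulrV : right_inverse fp_one fp_inv fp_mul.
Proof.
move=> x; rewrite -[x]fp_reprK fp_invE fp_mulE.
by apply/fp_classP; exact: word_mulV.
Qed.

HB.instance Definition _ := isGroup.Build free_product
  fp_mulA fp_mul1 fp_mulr1 fp_mulV fp_mulrV.

Definition fp_inj (i : I) (g : G i) : free_product := fp_class [:: letter g].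

End FreeProduct.

Inductive normal_closure (G : groupType) (R : set G) : set G :=
| nc_gen r : R r -> normal_closure R r
| nc_one : normal_closure R 1
| nc_mul x y :
    normal_closure R x -> normal_closure R y -> normal_closure R (x * y)
| nc_inv x : normal_closure R x -> normal_closure R x^-1
| nc_conj x y : normal_closure R x -> normal_closure R (x ^ y).

Section QuotientByRelators.
Variables (G : groupType) (R : set G).

Definition rel_eqb (x y : G) : bool := `[< normal_closure R (x^-1 * y) >].

Lemma rel_eqb_refl : reflexive rel_eqb.
Proof. by move=> x; apply/asboolP; rewrite mulVg; exact: nc_one. Qed.

Lemma rel_eqb_sym : symmetric rel_eqb.
Proof.
by move=> x y; apply/asboolP/asboolP => /nc_inv; rewrite invgM invgK.
Qed.

Lemma rel_eqb_trans : transitive rel_eqb.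
Proof.
move=> y x z /asboolP xy /asboolP yz; apply/asboolP.
by have := nc_mul xy yz; rewrite mulgA mulgK.
Qed.

Canonical rel_equiv := EquivRel rel_eqb rel_eqb_refl rel_eqb_sym rel_eqb_trans.

Definition relator_quotient := {eq_quot rel_equiv}.

HB.instance Definition _ := Choice.on relator_quotient.

Definition rq_class (x : G) : relator_quotient := \pi_({eq_quot rel_equiv}) x.

Definition rq_repr (x : relator_quotient) : G := repr (x : {eq_quot rel_equiv}).

Lemma rq_reprK x : rq_class (rq_repr x) = x.
Proof. exact: reprK. Qed.

Lemma rq_classP x y : rq_class x = rq_class y <-> normal_closure R (x^-1 * y).
Proof.
by split=> [/eqmodP/asboolP|xy]; last by apply/eqmodP/asboolP.
Qed.

Lemma rq_repr_class x : normal_closure R ((rq_repr (rq_class x))^-1 * x).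
Proof. by apply/rq_classP; rewrite rq_reprK. Qed.

Definition rq_mul (x y : relator_quotient) := rq_class (rq_repr x * rq_repr y).
Definition rq_one : relator_quotient := rq_class 1.
Definition rq_inv (x : relator_quotient) := rq_class (rq_repr x)^-1.

Lemma rq_mulE x y : rq_mul (rq_class x) (rq_class y) = rq_class (x * y).
Proof.
apply/rq_classP; set x' := rq_repr _; set y' := rq_repr _.
have /(nc_conj y) xx : normal_closure R (x'^-1 * x) by exact: rq_repr_class.
have yy : normal_closure R (y'^-1 * y) by exact: rq_repr_class.
have := nc_mul yy xx.
by rewrite /conjg !mulgA invgM mulgK.
Qed.

Lemma rq_invE x : rq_inv (rq_class x) = rq_class x^-1.
Proof.
apply/rq_classP; set x' := rq_repr _.
have /nc_inv/(nc_conj x'^-1) : normal_closure R (x'^-1 * x).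
  exact: rq_repr_class.
by rewrite /conjg invgM !invgK -!mulgA mulgV mulg1.
Qed.

Lemma rq_mulA : associative rq_mul.
Proof.
move=> x y z; rewrite -[x]rq_reprK -[y]rq_reprK -[z]rq_reprK.
by rewrite !rq_mulE mulgA.
Qed.

Lemma rq_mul1 : left_id rq_one rq_mul.
Proof. by move=> x; rewrite -[x]rq_reprK rq_mulE mul1g. Qed.

Lemma rq_mulr1 : right_id rq_one rq_mul.
Proof. by move=> x; rewrite -[x]rq_reprK rq_mulE mulg1. Qed.

Lemma rq_mulV : left_inverse rq_one rq_inv rq_mul.
Proof. by move=> x; rewrite -[x]rq_reprK rq_invE rq_mulE mulVg. Qed.

Lemma rq_mulrV : right_inverse rq_one rq_inv rq_mul.
Proof. by move=> x; rewrite -[x]rq_reprK rq_invE rq_mulE mulgV. Qed.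

HB.instance Definition _ := isGroup.Build relator_quotient
  rq_mulA rq_mul1 rq_mulr1 rq_mulV rq_mulrV.

End QuotientByRelators.

(* The values c i i on the diagonal are irrelevant. *)
Definition graph_relators (I : choiceType) (G : I -> groupType) (c : rel I) :
    set (free_product G) :=
  [set r | exists i j (g : G i) (h : G j),
     [/\ i != j, c i j & r = [~ fp_inj g, fp_inj h]]].

Definition graph_product (I : choiceType) (G : I -> groupType) (c : rel I) :
    groupType :=
  relator_quotient (@graph_relators I G c).

(* Main.v *)
Require Import Defs.
From mathcomp Require Import all_boot.
From mathcomp Require Import finmap boolp classical_sets cardinality zify.

(** Let [H] be the graph product of the [G i], and let [U] be the disjoint union
of faithful [G i]-sets [X i] of growth at most [f], each [G i] fixing the
summands of the other factors.  The [H]-set that proves the theorem is a union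
of chains.  A chain is a finite line of copies of [U], called blocks.  Block
[j] has a label [i], which is the factor that acts on it, and two distinct
marked points, its source and its target; the target of block [j] is glued to
the source of block [j+1].  The factor [i] acts on the blocks labelled [i] and
fixes all the other points.  Consecutive labels are required to be distinct and
non-commuting in the graph product.  Therefore the blocks of one label are
disjoint, so the action of each factor is well defined; and the supports of two
commuting factors are disjoint, so their actions commute.  Hence [H] acts on
every chain.

Growth ([covered_nearby], [nearby_run]).  A word of length [n] can cross at
most about [n] blocks in either direction.  In each block it reaches only points
at distance at most [n] from the two marked points, or from the starting point.
This is at most [2n+1] blocks, each contributing at most three balls of
cardinality [f(n)], whence the bound [n f(n)].

Faithfulness ([follow], [minimal_moves]).  Write an element of [H] other than 1
as a word of minimal length in the letters of the factors.  A chain is built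
while reading the word: a letter that commutes with the label of the last block
is skipped, and any other letter [g] appends a block whose source is a point [x]
moved by [g] and whose target is [g x].  By minimality the word never contains
two letters of one factor that could be brought together, so the new label
differs from the last one and the chain is admissible.  The word carries the
beginning of the chain to its end, hence moves it.  No normal form theorem for
graph products enters: the chains themselves show that minimal nonempty words
are nontrivial.

Only three properties of [H] matter: the factors generate it, the prescribed
pairs commute, and any compatible family of actions of the factors extends to
an action of [H] ([presented_by]).  The free product is the case where no pair
commutes.

The growth bounds of the factors come with different constants, and [f] need
not be monotone.  All bounds can nevertheless be evaluated at the same argument
of [f], a common multiple of the constants, because it is the orbit growth that
increases with [n] ([uniform_growth]). *)

Set Implicit Arguments.
Unset Strict Implicit.
Unset Printing Implicit Defensive.

Local Open Scope classical_set_scope.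
Local Open Scope group_scope.

(** * Cardinality bounds by lists*)

(** A cardinality bound that includes finiteness, and which passes to subsets,
unions and images without a finiteness side condition. *)
Definition covered (T : Type) (A : set T) (m : nat) : Prop :=
  exists2 s : seq {classic T}, (size s <= m)%N &
    forall x : {classic T}, A x -> x \in s.

Lemma covered_sub (T : Type) (A B : set T) m n :
  A `<=` B -> (m <= n)%N -> covered B m -> covered A n.
Proof.
move=> AB mn [s sm Bs]; exists s; first exact: leq_trans mn.
by move=> x /AB /Bs.
Qed.

Lemma covered0 (T : Type) : covered (@set0 T) 0.
Proof. by exists [::]. Qed.

Lemma covered1 (T : Type) (x : T) : covered [set x] 1.
Proof. by exists [:: x : {classic T}] => // y ->; rewrite mem_head. Qed.

Lemma covered_gt0 (T : Type) (A : set T) m x : covered A m -> A x -> (0 < m)%N.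
Proof.
by move=> [[|y s] sm As] Ax; [have := As x Ax | exact: leq_trans sm].
Qed.

Lemma coveredU (T : Type) (A B : set T) m n :
  covered A m -> covered B n -> covered (A `|` B) (m + n).
Proof.
move=> [s sm As] [t tn Bt]; exists (s ++ t); first by rewrite size_cat leq_add.
by move=> x [/As|/Bt] xs; rewrite mem_cat xs ?orbT.
Qed.

Lemma covered_image (T T' : Type) (F : T -> T') (A : set T) m :
  covered A m -> covered (F @` A) m.
Proof.
move=> [s sm As]; exists (@map {classic T} {classic T'} F s).
  by rewrite size_map.
by move=> _ [x /As xs <-]; exact: (@map_f {classic T} {classic T'} F s x).
Qed.

Lemma covered_bigcup (J : eqType) (T : Type) (r : seq J) (A : J -> set T) m :
  (forall j, covered (A j) m) ->
  covered [set x | exists2 j, j \in r & A j x] (size r * m).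
Proof.
move=> Am; elim: r => [|j r IHr].
  by apply: covered_sub (covered0 T) => // x [].
rewrite mulSn; apply: covered_sub (coveredU (Am j) IHr) => // x [i].
by rewrite inE => /predU1P[->|ir] Ai; [left | right; exists i].
Qed.

(** * Balls, orbits and the growth function *)

Section Balls.
Variables (G : groupType) (S : {fset G}).

Lemma word_ball_mono n m : (n <= m)%N -> word_ball S n `<=` word_ball S m.
Proof.
by move=> nm g [w [wn wS ->]]; exists w; split=> //; exact: leq_trans nm.
Qed.

Lemma word_ball1 n : word_ball S n 1.
Proof. by exists [::]; split=> //; rewrite big_nil. Qed.

Lemma word_ball_gen s : s \in S -> word_ball S 1 s.
Proof.
move=> sS; exists [:: s]; split=> //; last by rewrite big_seq1.
by move=> x; rewrite inE => /eqP ->.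
Qed.

Lemma word_ball_mul n m g h :
  word_ball S n g -> word_ball S m h -> word_ball S (n + m) (g * h).
Proof.
move=> [u [un uS ->]] [v [vm vS ->]]; exists (u ++ v); split.
- by rewrite size_cat leq_add.
- by move=> x; rewrite mem_cat => /orP[/uS|/vS].
- by rewrite big_cat.
Qed.

Lemma word_ballS n g : word_ball S n.+1 g ->
  g = 1 \/ exists s h, [/\ s \in S, word_ball S n h & g = s * h].
Proof.
move=> [[|s w] [wn wS ->]]; first by left; rewrite big_nil.
right; exists s, (\prod_(x <- w) x); split; last by rewrite big_cons.
- by apply: wS; rewrite mem_head.
- by exists w; split=> // x xw; apply: wS; rewrite inE xw orbT.
Qed.

Lemma covered_word_ball n : exists m, covered (word_ball S n) m.
Proof.
elim: n => [|n [m IHn]].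
  exists 1%N; apply: covered_sub (covered1 1) => // g [[|s w] [sz _ ->]] //.
  by rewrite big_nil.
exists (1 + size S * m)%N.
apply: covered_sub (coveredU (covered1 (1 : G))
  (covered_bigcup S (fun s => covered_image (fun h => s * h) IHn))) => //.
move=> g /word_ballS[->|[s [h [sS hn ->]]]]; first by left.
by right; exists s => //; exists h.
Qed.

Section Orbit.
Variables (X : Type) (a : action G X).

Definition orbit_ball (n : nat) (x : X) : set X :=
  [set a g x | g in word_ball S n].

Lemma orbit_ball_cardP n x m :
  (orbit_ball_card S a n x <= m)%N <-> covered (orbit_ball n x) m.
Proof.
rewrite /orbit_ball_card.
set A : set {classic X} := [set _ | _ in _].
have finA : finite_set A.
  have [k /(covered_image (fun g => a g x)) [s _ As]] := covered_word_ball n.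
  by apply: sub_finite_set (finite_seq s) => y /As.
split=> [Am|[s sm As]].
  exists (fset_set A) => // y Ay.
  by rewrite in_fset_set // inE.
apply: leq_trans sm; apply: leq_trans (size_undup s).
rewrite -card_fseq; apply: fsubset_leq_card; apply/fsubsetP => y.
by rewrite in_fset_set // !inE; exact: As.
Qed.

(** [vol] is defined by choosing a maximum; one exists because all the orbits
of radius [n] are bounded by the cardinality of the ball. *)
Lemma orbit_card_le_vol n x : (orbit_ball_card S a n x <= vol S a n)%N.
Proof.
have [k cov] := covered_word_ball n.
have bnd y : (orbit_ball_card S a n y <= k)%N.
  by apply/orbit_ball_cardP; exact: covered_image.
pose P m := `[< exists y, orbit_ball_card S a n y = m >].
have exP : exists m, P m.
  by exists (orbit_ball_card S a n x); apply/asboolP; exists x.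
have ubP m : P m -> (m <= k)%N by move=> /asboolP[y <-].
have [m /asboolP Pm mmax] := ex_maxnP exP ubP.
rewrite /vol; case: xgetP => [v|none]; first by move=> _ [_ +]; apply.
by case: (none m); split=> // y; apply: mmax; apply/asboolP; exists y.
Qed.

Lemma vol_le n m :
  (forall x, orbit_ball_card S a n x <= m)%N -> (vol S a n <= m)%N.
Proof. by move=> bnd; rewrite /vol; case: xgetP => // v _ [[x <-]]. Qed.

End Orbit.
End Balls.

(** * The action of the factors on a chain *)

(** The letters of a word act in reading order, so the head of the list acts
first. *)
Definition run (I : Type) (G : I -> groupType) (X : Type)
    (A : forall i, G i -> X -> X) (x : X) (w : seq {i : I & G i}) : X :=
  foldl (fun p l => A (tag l) (tagged l) p) x w.

Lemma run_rcons (I : Type) (G : I -> groupType) (X : Type)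
    (A : forall i, G i -> X -> X) (x : X) w l :
  run A x (rcons w l) = A (tag l) (tagged l) (run A x w).
Proof. exact: foldl_rcons. Qed.

Section Chains.
Variables (I : eqType) (G : I -> groupType) (c : rel I) (U : Type).
Variable a : forall i, action (G i) U.

Record block := Block { label : I; source : U; target : U }.

(** [inl j] is the marked point between the blocks [j-1] and [j]; [inr (j, u)]
is the point [u] inside the block [j]. *)
Definition vertex : Type := nat + nat * U.

(** The inclusion of block [j] in the chain.  The vertices [inr (j, source t)]
and [inr (j, target t)] are not in its image: they are isolated points, fixed
by every factor, kept so that the set of vertices is the same for all chains. *)
Definition place (j : nat) (t : block) (u : U) : vertex :=
  if `[< u = source t >] then inl j
  else if `[< u = target t >] then inl j.+1 else inr (j, u).

Definition moving (t : block) : bool := `[< source t <> target t >].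
Definition linked : rel I := [rel i j | (i != j) && ~~ c i j].

Definition chain_ok (ch : seq block) : bool :=
  sorted linked (map label ch) && all moving ch.

Lemma place_source j t : place j t (source t) = inl j.
Proof. by rewrite /place; case: asboolP. Qed.

Lemma place_target j t : moving t -> place j t (target t) = inl j.+1.
Proof.
move=> /asboolP mt; rewrite /place; case: asboolP => [/esym //|_].
by case: asboolP.
Qed.

(** Two blocks meet only where the target of one is glued to the source of the
next. *)
Lemma place_eq j t u j' t' u' : place j t u = place j' t' u' ->
  [\/ j = j' /\ (moving t -> t = t' -> u = u'),
      [/\ j' = j.+1, u = target t & u' = source t'] |
      [/\ j = j'.+1, u = source t & u' = target t']].
Proof.
rewrite /place.
case: (asboolP (u = source t)) => us; case: (asboolP (u' = source t')) => us'.
- by case=> ->; constructor 1; split=> // _ tt; rewrite us us' tt.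
- by case: asboolP => // ut' [->]; constructor 3.
- by case: asboolP => // ut [<-]; constructor 2.
- case: asboolP => ut; case: asboolP => ut' //.
    by case=> ->; constructor 1; split=> // _ tt; rewrite ut ut' tt.
  by case=> -> ->; constructor 1.
Qed.

Definition in_block (ch : seq block) (i : I) (p : vertex) j t u : Prop :=
  [/\ onth ch j = Some t, label t = i & place j t u = p].

(** The action of the factor [i] is the identity off the blocks labelled [i];
on these it is read through the inclusion of the block.  The choice of a block
containing [p] is harmless, because it is unique in a valid chain
([in_block_inj]). *)
Definition step (ch : seq block) (i : I) (g : G i) (p : vertex) : vertex :=
  if pselect (exists z, in_block ch i p z.1.1 z.1.2 z.2) is left h
  then let z := projT1 (cid h) in place z.1.1 z.1.2 (a i g z.2)
  else p.

Lemma step_out ch i (g : G i) p :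
  (forall j t u, ~ in_block ch i p j t u) -> step ch g p = p.
Proof.
by move=> out; rewrite /step; case: pselect => // -[z b]; case: (out _ _ _ b).
Qed.

Lemma onth_moving ch j t : chain_ok ch -> onth ch j = Some t -> moving t.
Proof.
move=> /andP[_]; elim: ch j => [|t0 ch IHch] [|j] //= /andP[m0 mch].
  by case=> <-.
exact: IHch.
Qed.

Lemma onth_linked ch j t t' : chain_ok ch ->
  onth ch j = Some t -> onth ch j.+1 = Some t' -> linked (label t) (label t').
Proof.
move=> /andP[+ _]; elim: ch j => [|t0 ch IHch] // j.
case: ch IHch => [|t1 ch] IHch; first by case: j.
rewrite [sorted _ _]/= => /andP[l01 srt]; case: j => [|j].
  by move=> [<-] [<-].
exact: IHch.
Qed.

Section Nearby.
Variables (ch : seq block) (S : forall i, {fset G i}).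

Definition position (p : vertex) : nat :=
  match p with inl j => j | inr (j, _) => j end.

(** The points of a block from which the motion can start: a walk that begins
at [p] enters the block through a marked point, unless [p] lies inside it. *)
Definition base (p : vertex) (t : block) : set U :=
  [set u | [\/ u = source t, u = target t | exists j, p = inr (j, u)]].

(** A superset of the ball of radius [n] around [p], in a form that is stable
under one step, up to increasing [n]. *)
Definition nearby (p : vertex) (n : nat) (q : vertex) : Prop :=
  q = p \/ exists j t u g,
    [/\ onth ch j = Some t, (j <= position p + n)%N && (position p <= j + n)%N,
        base p t u, word_ball (S (label t)) n g & q = place j t (a (label t) g u)].

Lemma place_base j t u p : place j t u = p ->
  (position p <= j.+1)%N && (j <= position p)%N /\ base p t u.
Proof.
rewrite /place; case: asboolP => [->|_] => [<-|].
  by split=> /=; [lia|constructor 1].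
case: asboolP => [->|_] <-; first by split=> /=; [lia|constructor 2].
by split=> /=; [lia|constructor 3; exists j].
Qed.

Lemma nearby_mono p n m q : (n <= m)%N -> nearby p n q -> nearby p m q.
Proof.
move=> nm [->|[j [t [u [g [tj jp b gn ->]]]]]]; first by left.
right; exists j, t, u, g; split=> //; first by lia.
exact: word_ball_mono gn.
Qed.

(** There are [2n+1] blocks to consider and three starting points in each. *)
Lemma covered_nearby p n V :
  (forall i u, covered (orbit_ball (S i) (a i) n u) V) ->
  covered (nearby p n) (1 + (2 * n).+1 * (V + V + V)).
Proof.
move=> cov.
pose A j : set vertex := if onth ch j is Some t then
  place j t @` (orbit_ball (S (label t)) (a (label t)) n (source t) `|`
                orbit_ball (S (label t)) (a (label t)) n (target t) `|`
    if p is inr (_, u) then orbit_ball (S (label t)) (a (label t)) n u else set0)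
  else set0.
have Acov j : covered (A j) (V + V + V).
  rewrite /A; case: onth => [t|]; last exact: covered_sub (@covered0 _).
  apply: covered_image; apply: coveredU; first exact: coveredU.
  by clear A; case: p => [k|[k u]] //; exact: covered_sub (@covered0 _).
rewrite -(size_iota (position p - n) (2 * n).+1).
apply: covered_sub (coveredU (covered1 p) (covered_bigcup _ Acov)) => // q.
case=> [->|[j [t [u [g [tj jp b gn ->]]]]]]; first by left.
right; exists j; first by rewrite mem_iota; lia.
rewrite /A tj; exists (a (label t) g u) => //.
case: b => [->|->|[k ->]]; first by left; left; exists g.
  by left; right; exists g.
by right; exists g.
Qed.

End Nearby.

Section ValidChain.
Variable ch : seq block.
Hypothesis chP : chain_ok ch.

(** A vertex in two different blocks is the point at which they are glued, so
the blocks are consecutive and their labels are linked. *)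
Lemma in_block_meet i i' p j t u j' t' u' :
  in_block ch i p j t u -> in_block ch i' p j' t' u' ->
  [/\ j = j', t = t' & u = u'] \/
  [/\ linked i i' || linked i' i & (j <= j'.+1)%N && (j' <= j.+1)%N].
Proof.
move=> [tj <- <-] [tj' <- /esym eqp].
have mt := onth_moving chP tj.
case: (place_eq eqp) => [[jj uu]|[jj _ _]|[jj _ _]].
- left; move: tj'; rewrite -jj tj => -[tt]; split=> //; exact: uu.
- right; split; last by lia.
  by rewrite jj in tj'; rewrite (onth_linked chP tj tj').
- right; split; last by lia.
  by rewrite jj in tj; rewrite (onth_linked chP tj' tj) orbT.
Qed.

Lemma in_block_inj i p j t u j' t' u' :
  in_block ch i p j t u -> in_block ch i p j' t' u' ->
  [/\ j = j', t = t' & u = u'].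
Proof.
by move=> b b'; case: (in_block_meet b b') => // -[]; rewrite /linked /= eqxx.
Qed.

Lemma step_in i (g : G i) p j t u :
  in_block ch i p j t u -> step ch g p = place j t (a i g u).
Proof.
move=> b; rewrite /step; case: pselect => [h|[]]; last by exists (j, t, u).
case: cid => -[[j' t'] u'] /= b'.
by have [-> -> ->] := in_block_inj b b'.
Qed.

Lemma step_in_block i (g : G i) p j t u :
  in_block ch i p j t u -> in_block ch i (step ch g p) j t (a i g u).
Proof. by move=> b; rewrite (step_in g b); case: b => ? ? _. Qed.

Lemma in_blockVout i p : (exists z, in_block ch i p z.1.1 z.1.2 z.2) \/
  (forall j t u, ~ in_block ch i p j t u).
Proof.
have [b|nb] := pselect (exists z, in_block ch i p z.1.1 z.1.2 z.2).
  by left.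
by right=> j t u b; apply: nb; exists (j, t, u).
Qed.

Lemma step1 i p : step ch (1 : G i) p = p.
Proof.
case: (in_blockVout i p) => [[z b]|out]; last exact: step_out.
by rewrite (step_in _ b) act1; case: b.
Qed.

Lemma stepM i (g h : G i) p : step ch (g * h) p = step ch g (step ch h p).
Proof.
case: (in_blockVout i p) => [[z b]|out]; last by rewrite !step_out.
by rewrite (step_in _ b) actM (step_in _ (step_in_block h b)).
Qed.

(** Commuting factors have disjoint supports, since blocks that meet have
linked labels. *)
Lemma in_block_out i i' p j t u :
  i != i' -> c i i' -> c i' i -> in_block ch i p j t u ->
  forall j' t' u', ~ in_block ch i' p j' t' u'.
Proof.
move=> ii' ci ci' b j' t' u' b'.
case: (in_block_meet b b') => [[_ tt _]|[]].
  by case: b b' ii' => _ <- _ [_ <- _]; rewrite tt eqxx.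
by rewrite /linked /= ci ci' /= !andbF.
Qed.

Lemma step_comm i i' (g : G i) (h : G i') p :
  i != i' -> c i i' -> c i' i ->
  step ch g (step ch h p) = step ch h (step ch g p).
Proof.
move=> ii' ci ci'; have i'i : i' != i by rewrite eq_sym.
case: (in_blockVout i p) => [[z b]|out].
  have out' := in_block_out ii' ci ci' b.
  have out'' := in_block_out ii' ci ci' (step_in_block g b).
  by rewrite (step_out _ out') (step_out _ out'').
case: (in_blockVout i' p) => [[z b]|out'].
  have out'' := in_block_out i'i ci' ci (step_in_block h b).
  by rewrite (step_out _ out'') (step_out _ out).
by rewrite !step_out.
Qed.

Section Growth.
Variable S : forall i, {fset G i}.

(** If the block that carries the current point is not the one recorded in
[nearby], then the walk has just crossed a glued point: the new block is
adjacent to the old one, and the walk restarts there from a marked point. *)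
Lemma nearby_step p n q i s :
  s \in S i -> nearby ch S p n q -> nearby ch S p n.+1 (step ch s q).
Proof.
move=> sS; case: (in_blockVout i q) => [[[[j t] u] b]|out]; last first.
  by rewrite step_out //; apply: nearby_mono.
rewrite (step_in _ b); move: b => /= [tj lt pq]; subst i.
have s1 : word_ball (S (label t)) n.+1 s.
  exact: word_ball_mono (word_ball_gen sS).
case=> [qp|[j' [t' [u' [g [tj' jp b gn qE]]]]]].
  rewrite qp in pq; have [jp b] := place_base pq.
  by right; exists j, t, u, s; split=> //; lia.
rewrite qE in pq.
case: (place_eq pq) => [[jj uu]|[jj ut _]|[jj us _]].
- subst j'; move: tj'; rewrite tj => -[tt]; subst t'.
  right; exists j, t, u', (s * g); split=> //; first by lia.
    exact: (word_ball_mul (word_ball_gen sS) gn).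
  by rewrite actM uu //; exact: (onth_moving chP tj).
- right; exists j, t, u, s; split=> //; first by lia.
  by constructor 2.
- right; exists j, t, u, s; split=> //; first by lia.
  by constructor 1.
Qed.

Lemma nearby_run p w n : (size w <= n)%N ->
  all (fun l => tagged l \in S (tag l)) w -> nearby ch S p n (run (step ch) p w).
Proof.
elim/last_ind: w n => [|w l IHw] [|n] //; rewrite ?size_rcons //; first by left.
  by left.
rewrite ltnS all_rcons => wn /andP[lS wS].
rewrite run_rcons; apply: nearby_step => //; exact: IHw.
Qed.

End Growth.
End ValidChain.
End Chains.

Arguments label {I U} b.
Arguments source {I U} b.
Arguments target {I U} b.

Lemma exists_moved (G : groupType) (X : Type) (a : action G X) (g : G) :
  faithful a -> g <> 1 -> exists x, x <> a g x.
Proof.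
move=> fa g1; apply: contrapT => nex; apply: g1; apply: fa => x.
by apply: contrapT => ax; apply: nex; exists x => /esym.
Qed.

(** * The disjoint union of the sets of the factors *)

Section Summands.
Variables (I : eqType) (G : I -> groupType) (X : I -> Type).
Variable a : forall i, action (G i) (X i).

(** The letter [g] is transported to the factor of the summand of [u], as [g]
itself if this is the factor [i] and as 1 otherwise; this avoids casts. *)
Definition sum_act (i : I) (g : G i) (u : {i & X i}) : {i & X i} :=
  Tagged X (a (tag u) (dfwith (fun j => 1 : G j) g (tag u)) (tagged u)).

Lemma sum_act_in i (g : G i) x : sum_act g (Tagged X x) = Tagged X (a i g x).
Proof. by rewrite /sum_act /= dfwith_in. Qed.

Lemma sum_act_out i (g : G i) u : i != tag u -> sum_act g u = u.
Proof. by case: u => j x /= ij; rewrite /sum_act /= dfwith_out // act1. Qed.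

Lemma sum_act1 i u : sum_act (1 : G i) u = u.
Proof.
have [iu|iu] := eqVneq i (tag u); last by rewrite sum_act_out.
rewrite {i}iu.
case: u => j x; rewrite sum_act_in act1; exact: erefl.
Qed.

Lemma sum_actM i (g h : G i) u : sum_act (g * h) u = sum_act g (sum_act h u).
Proof.
have [iu|iu] := eqVneq i (tag u); last by rewrite !sum_act_out.
subst i; case: u g h => j x /= g h.
by rewrite (sum_act_in h x) !sum_act_in actM; exact: erefl.
Qed.

Definition sum_action i : action (G i) {i & X i} :=
  Action (@sum_act1 i) (@sum_actM i).

Lemma sum_action_faithful i : faithful (a i) -> faithful (sum_action i).
Proof.
move=> fa g fixg; apply: fa => x.
by apply: (@eq_from_Tagged I X); have := fixg (Tagged X x); rewrite /= sum_act_in.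
Qed.

Lemma covered_sum_action (S : forall i, {fset G i}) n V :
  (forall i x, covered (orbit_ball (S i) (a i) n x) V) ->
  forall i u, covered (orbit_ball (S i) (sum_action i) n u) V.
Proof.
move=> cov i u; have [iu|iu] := eqVneq i (tag u).
  rewrite iu; case: u {i iu} => i x.
  apply: covered_sub (covered_image (Tagged X) (cov i x)) => // _ [g gn <-].
  by exists (a i g x); [exists g | rewrite /= sum_act_in].
have V0 : (0 < V)%N.
  apply: (covered_gt0 (cov (tag u) (tagged u))).
  by exists 1; [exact: word_ball1 | exact: erefl].
apply: covered_sub (covered1 u) => // _ [g _ <-].
by rewrite /= sum_act_out.
Qed.

End Summands.

(** * Minimal words move the beginning of a chain *)

Section MinimalWords.
Variables (I : eqType) (G : I -> groupType) (H : groupType).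
Variable phi : forall i, G i -> H.
Hypothesis phiM : forall i (g h : G i), phi (g * h) = phi g * phi h.

(** The last letter is the leftmost factor, in agreement with the order in which
[run] lets the letters act. *)
Definition eval (w : seq {i & G i}) : H := run (fun i g x => phi g * x) 1 w.

Lemma eval_rcons w l : eval (rcons w l) = phi (tagged l) * eval w.
Proof. exact: run_rcons. Qed.

Lemma runE w x : run (fun i g x => phi g * x) x w = eval w * x.
Proof.
elim/last_ind: w => [|w l IHw]; first by rewrite mul1g.
by rewrite eval_rcons run_rcons IHw mulgA.
Qed.

Lemma eval_cons l w : eval (l :: w) = eval w * phi (tagged l).
Proof. by rewrite /eval /= runE mulg1. Qed.

Lemma phi1 i : phi (1 : G i) = 1.
Proof. by apply: (mulgI (phi (1 : G i))); rewrite -phiM !mulg1. Qed.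

Lemma phiV i (g : G i) : phi g^-1 = (phi g)^-1.
Proof. by apply: (mulgI (phi g)); rewrite -phiM !mulgV phi1. Qed.

(** Minimality is all that is used of reduced words: it passes to tails, and is
preserved when commuting letters are exchanged. *)
Definition minimal (w : seq {i & G i}) : Prop :=
  forall w', eval w' = eval w -> (size w <= size w')%N.

Lemma minimal_behead l w : minimal (l :: w) -> minimal w.
Proof. by move=> mw w' ww'; apply: (mw (l :: w')); rewrite !eval_cons ww'. Qed.

Lemma minimal_neq1 i (g : G i) w : minimal (Tagged G g :: w) -> g <> 1.
Proof.
move=> mw g1; have /mw : eval w = eval (Tagged G g :: w).
  by rewrite eval_cons /= g1 phi1 mulg1.
by rewrite ltnn.
Qed.

(** Two successive letters of one factor could be merged. *)
Lemma minimal_tag_neq l l' w : minimal (l :: l' :: w) -> tag l != tag l'.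
Proof.
case: l l' => i g [j h] mw; apply/eqP => /= ij; subst j.
have /mw : eval (Tagged G (h * g) :: w) = eval (Tagged G g :: Tagged G h :: w).
  by rewrite !eval_cons /= phiM mulgA.
by rewrite ltnn.
Qed.

(** After the exchange of [l] and [l'], the word [l :: w] is a tail of a word of
the same value and length. *)
Lemma minimal_skip l l' w :
  phi (tagged l) * phi (tagged l') = phi (tagged l') * phi (tagged l) ->
  minimal (l :: l' :: w) -> minimal (l :: w).
Proof.
move=> comm mw; apply: (@minimal_behead l') => w' ww'; apply: (mw w').
by rewrite ww' !eval_cons -!mulgA comm.
Qed.

Lemma exists_minimal w : exists2 w', minimal w' & eval w' = eval w.
Proof.
have [n] := ubnP (size w); elim: n w => // n IHn w wn.
have [mw|nmw] := pselect (minimal w); first by exists w.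
have [w' [ww' sw']] : exists w', eval w' = eval w /\ (size w' < size w)%N.
  apply: contrapT => nex; apply: nmw => w' ww'; rewrite leqNgt; apply/negP => sw'.
  by apply: nex; exists w'.
have [|w'' mw'' ww''] := IHn w'; first exact: leq_trans sw' _.
by exists w''; rewrite // ww''.
Qed.

Section Follow.
Variables (c : rel I) (U : Type) (a : forall i, action (G i) U).
Hypothesis c_sym : forall i j, i != j -> c i j = c j i.
Hypothesis phi_comm : forall i j (g : G i) (h : G j), i != j -> c i j ->
  phi g * phi h = phi h * phi g.
Hypothesis a_faithful : forall i, faithful (a i).

Lemma chain_ok_cat (ch0 ch : seq (block I U)) t0 :
  chain_ok c (rcons ch0 t0) -> path (linked c) (label t0) (map label ch) ->
  all (@moving I U) ch -> chain_ok c (rcons ch0 t0 ++ ch).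
Proof.
rewrite /chain_ok map_cat all_cat => /andP[s0 ->] s1 ->; rewrite !andbT.
case: ch0 s0 => [//|t ch0] /= s0.
by rewrite cat_path s0 map_rcons last_rcons.
Qed.

(** The letter [l0] is the one that created the last block [t0]; letters of
[w] that commute with it are skipped, so [l0 :: w] stays minimal and the next
letter that is not skipped belongs to another factor.  The part [ch0] of the
chain already built is arbitrary, because the letters of [w] act only from the end of
[t0] on. *)
Lemma follow w l0 : minimal (l0 :: w) ->
  exists ch : seq (block I U),
    [/\ path (linked c) (tag l0) (map label ch), all (@moving I U) ch &
     forall ch0 t0, chain_ok c (rcons ch0 t0) -> label t0 = tag l0 ->
       run (step a (rcons ch0 t0 ++ ch)) (inl (size ch0).+1) w =
       inl ((size ch0).+1 + size ch)%N].
Proof.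
elim: w l0 => [|l w IHw] l0 mw; first by exists [::]; split=> // *; rewrite addn0.
have ll := minimal_tag_neq mw.
have [lk|] := boolP (linked c (tag l0) (tag l)); last first.
  rewrite /linked /= ll negbK => cll.
  have [ch [pch mch runch]] := IHw l0 (minimal_skip (phi_comm _ _ ll cll) mw).
  exists ch; split=> // ch0 t0 ok0 lt0; rewrite /= -[RHS](runch ch0 t0) //.
  (* The current point is the target of [t0], on which the skipped letter acts
     trivially. *)
  congr run; apply: step_out.
  have okch : chain_ok c (rcons ch0 t0 ++ ch) by apply: chain_ok_cat; rewrite ?lt0.
  have cll' : c (tag l) (tag l0) by rewrite -c_sym.
  apply: (in_block_out okch ll cll cll' (j := size ch0) (t := t0) (u := target t0)).
  split=> //; last first.
    rewrite place_target //; apply: (onth_moving ok0 (j := size ch0)).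
    by rewrite -cats1 onth_cat ltnn subnn.
  by rewrite onth_cat size_rcons leqnn -cats1 onth_cat ltnn subnn.
have [ch [pch mch runch]] := IHw l (minimal_behead mw).
have l1 : tagged l <> 1.
  by case: l {IHw ll lk pch runch} mw => i g /minimal_behead/minimal_neq1.
have [x xl] := exists_moved (@a_faithful _) l1.
(* The letter [l] leads from the source of [t] to its target. *)
pose t := Block (tag l) x (a _ (tagged l) x).
have mt : moving t by apply/asboolP.
exists (t :: ch); split=> [||ch0 t0 ok0 lt0]; rewrite /= ?lk ?mt //.
have ok1 : chain_ok c (rcons (rcons ch0 t0) t).
  rewrite -[rcons (rcons _ _) _]cats1; apply: chain_ok_cat => //=.
    by rewrite lt0 lk.
  by rewrite mt.
have okch : chain_ok c (rcons (rcons ch0 t0) t ++ ch) by exact: chain_ok_cat.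
rewrite -cat_rcons addnS -addSn.
have := runch _ _ ok1 erefl; rewrite size_rcons => <-; congr run.
have b : in_block (rcons (rcons ch0 t0) t ++ ch) (tag l) (inl (size ch0).+1)
    (size ch0).+1 t (source t).
  split=> //; last exact: place_source.
  rewrite onth_cat !size_rcons ltnSn -cats1 onth_cat size_rcons ltnn subnn //.
by rewrite (step_in a okch _ b) (place_target _ mt).
Qed.

Lemma minimal_moves l w : minimal (l :: w) ->
  exists (ch : seq (block I U)) p,
    [/\ chain_ok c ch, (0 < size ch)%N & run (step a ch) p (l :: w) <> p].
Proof.
move=> mw; have [ch [pch mch runch]] := follow mw.
have l1 : tagged l <> 1.
  by case: l {pch runch} mw => i g /minimal_neq1.
have [x xl] := exists_moved (@a_faithful _) l1.
pose t := Block (tag l) x (a _ (tagged l) x).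
have mt : moving t by apply/asboolP.
have ok0 : chain_ok c (rcons [::] t) by rewrite /chain_ok /= mt.
have okch : chain_ok c (t :: ch) by rewrite -cat1s; exact: (chain_ok_cat ok0).
exists (t :: ch), (inl 0%N); split=> //.
have b : in_block (t :: ch) (tag l) (inl 0%N) 0 t (source t).
  by split=> //; exact: place_source.
rewrite /= (step_in a okch _ b) (place_target _ mt).
by rewrite (runch [::] t).
Qed.

End Follow.
End MinimalWords.

(** * Groups presented as graph products *)

(** The universal property is stated for actions on sets, the only form in
which it is used. *)
Record presented_by (I : eqType) (G : I -> groupType) (c : rel I)
    (H : groupType) (phi : forall i, G i -> H) : Prop := PresentedBy {
  presented_morph : forall i (g h : G i), phi i (g * h) = phi i g * phi i h;
  presented_comm : forall i j (g : G i) (h : G j), i != j -> c i j ->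
    phi i g * phi j h = phi j h * phi i g;
  presented_gen : forall x, exists w, x = eval phi w;
  presented_univ : forall (X : Type) (a : forall i, action (G i) X),
    (forall i j (g : G i) (h : G j) x, i != j -> c i j ->
       a i g (a j h x) = a j h (a i g x)) ->
    exists A : action H X, forall i (g : G i) x, A (phi i g) x = a i g x }.

(** With [P] the product of the constants [K i] and [P = K i * m], the growth at
[n] is at most the growth at [10 m n], hence at most [K i * f (10 P n)].  The
factor 10 leaves room for the constant of the growth of chains. *)
Lemma uniform_growth (I : finType) (G : I -> groupType) (X : I -> Type)
    (a : forall i, action (G i) (X i)) (S : forall i, {fset G i})
    (f : nat -> nat) :
  (forall i, growth_le (vol (S i) (a i)) f) ->
  exists2 K, (0 < K)%N & forall n i x, (1 <= n)%N ->
    covered (orbit_ball (S i) (a i) n x) (K * f (10 * K * n)%N).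
Proof.
move=> grow.
have /fin_all_exists[K KP] : forall i, exists K, (0 < K)%N /\
    forall n, (1 <= n)%N -> (vol (S i) (a i) n <= K * f (K * n))%N.
  by move=> i; have [K K0 KP] := grow i; exists K.
pose P := (\prod_i K i)%N.
have P0 : (0 < P)%N by apply: prodn_gt0 => i; case: (KP i).
exists P => // n i x n0; have [Ki0 KiP] := KP i.
have [m PE] : exists m, P = (K i * m)%N by rewrite /P (bigD1 i) //=; eexists.
have m0 : (0 < m)%N by move: P0; rewrite PE muln_gt0 => /andP[].
have : covered (orbit_ball (S i) (a i) (10 * m * n) x)
    (K i * f (K i * (10 * m * n))%N).
  apply/orbit_ball_cardP; apply: leq_trans (orbit_card_le_vol _ _ _ _) _.
  by apply: KiP; lia.
have -> : (K i * (10 * m * n) = 10 * P * n)%N by rewrite PE; lia.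
apply: covered_sub; last by rewrite leq_mul2r PE leq_pmulr ?orbT.
by move=> _ [g gn <-]; exists g => //; apply: word_ball_mono gn; nia.
Qed.

Section Product.
Variables (I : finType) (G : I -> groupType) (c : rel I) (H : groupType).
Variable phi : forall i, G i -> H.
Hypothesis c_sym : forall i j, i != j -> c i j = c j i.
Hypothesis phiP : presented_by c phi.

Let phiM := presented_morph phiP.

Lemma action_eval (X : Type) (a : forall i, action (G i) X) (A : action H X) :
  (forall i (g : G i) x, A (phi g) x = a i g x) ->
  forall w x, A (eval phi w) x = run a x w.
Proof.
move=> Aphi; elim/last_ind => [|w l IHw] x; first exact: act1.
by rewrite eval_rcons run_rcons actM Aphi IHw.
Qed.

Section Generators.
Variable S : forall i, {fset G i}.

Definition union_gens : {fset H} :=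
  seq_fset tt (flatten [seq [seq phi s | s <- S i] | i <- enum I]).

Lemma union_gensP x :
  reflect (exists i, exists2 s, s \in S i & x = phi s) (x \in union_gens).
Proof.
rewrite seq_fsetE; apply: (iffP flatten_mapP) => [[i _ /mapP[s sS ->]]|].
  by exists i, s.
by move=> [i [s sS ->]]; exists i; rewrite ?mem_enum //; exact: map_f.
Qed.

Lemma union_gens_symmetric :
  (forall i, symmetric_set (S i)) -> symmetric_set union_gens.
Proof.
move=> symS x /union_gensP[i [s sS ->]]; apply/union_gensP.
by exists i, s^-1; [exact: symS | rewrite phiV].
Qed.

Lemma word_ball_phi i n (g : G i) :
  word_ball (S i) n g -> word_ball union_gens n (phi g).
Proof.
elim: n g => [|n IHn] g.
  move=> [[|s w] [sz _ ->]] //; rewrite big_nil phi1 //; exact: word_ball1.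
move=> /word_ballS[->|[s [h [sS hn ->]]]].
  by rewrite phi1 //; exact: word_ball1.
rewrite phiM -add1n; apply: word_ball_mul (IHn _ hn).
by apply: word_ball_gen; apply/union_gensP; exists i, s.
Qed.

Lemma union_gens_generating :
  (forall i, generating_set (S i)) -> generating_set union_gens.
Proof.
move=> genS x; have [w ->] := presented_gen phiP x.
elim/last_ind: w => [|w [i g] [n IHw]]; first by exists 0%N; exact: word_ball1.
have [m gm] := genS i g; exists (m + n)%N; rewrite eval_rcons.
exact: word_ball_mul (word_ball_phi gm) IHw.
Qed.

Lemma word_ball_union n x : word_ball union_gens n x -> exists w,
  [/\ (size w <= n)%N, all (fun l => tagged l \in S (tag l)) w & x = eval phi w].
Proof.
elim: n x => [|n IHn] x.
  by move=> [[|s w] [sz _ ->]] //; exists [::]; rewrite big_nil.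
move=> /word_ballS[->|[s [h [/union_gensP[i [g gS ->]] /IHn[w [wn wS ->]] ->]]]].
  by exists [::].
exists (rcons w (Tagged G g)); split.
- by rewrite size_rcons.
- by rewrite all_rcons /= gS.
- by rewrite eval_rcons.
Qed.

End Generators.

(** * The union of all chains *)

Section ChainSpace.
Variables (U : Type) (a : forall i, action (G i) U).

(** Chains are nonempty: a chain then contains a point of [U], so that the bound
of the growth of the factors is at least 1.  When every factor is trivial on
an empty set, there is no chain and the growth is 0, as it must be. *)
Definition chain : Type :=
  {ch : seq (block I U) | chain_ok c ch && (0 < size ch)%N}.

Lemma chainP (ch : chain) : chain_ok c (val ch).
Proof. by case/andP: (valP ch). Qed.

Definition chain_act i (g : G i) (p : chain * vertex U) : chain * vertex U :=
  (p.1, step a (val p.1) g p.2).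

Lemma chain_act1 i p : chain_act (1 : G i) p = p.
Proof. by case: p => ch p; rewrite /chain_act (step1 _ (chainP ch)). Qed.

Lemma chain_actM i (g h : G i) p :
  chain_act (g * h) p = chain_act g (chain_act h p).
Proof. by case: p => ch p; rewrite /chain_act (stepM _ (chainP ch)). Qed.

Definition chain_action i : action (G i) (chain * vertex U) :=
  Action (@chain_act1 i) (@chain_actM i).

Lemma chain_action_comm i j (g : G i) (h : G j) p : i != j -> c i j ->
  chain_action i g (chain_action j h p) = chain_action j h (chain_action i g p).
Proof.
case: p => ch p ij cij; have cji : c j i by rewrite -c_sym.
by rewrite /= /chain_act /= (step_comm _ (chainP ch)).
Qed.

Lemma run_chain w ch p :
  run chain_action (ch, p) w = (ch, run (step a (val ch)) p w).
Proof. by elim/last_ind: w => // w l IHw; rewrite !run_rcons IHw. Qed.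

Variable A : action H (chain * vertex U).
Hypothesis A_phi : forall i (g : G i) x, A (phi g) x = chain_action i g x.

Lemma chain_faithful : (forall i, faithful (a i)) -> faithful A.
Proof.
move=> fa x fixx; have [w0 x0] := presented_gen phiP x.
have [[|l w] mw xE] := exists_minimal phi w0; first by rewrite x0 -xE.
have [ch [p [ok sz []]]] :=
  minimal_moves phiM c_sym (presented_comm phiP) fa mw.
have okch : chain_ok c ch && (0 < size ch)%N by rewrite ok.
have := fixx (exist _ ch okch, p).
rewrite x0 -xE (action_eval A_phi) run_chain.
by move/(congr1 snd).
Qed.

(** The count of [covered_nearby], namely [1 + 3 (2n+1) V], is at most [10 n V]
when [n] and [V] are positive; [V] is, since a chain provides a point of [U]. *)
Lemma chain_growth (S : forall i, {fset G i}) n V : (1 <= n)%N ->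
  (forall i u, covered (orbit_ball (S i) (a i) n u) V) ->
  (vol (union_gens S) A n <= 10 * n * V)%N.
Proof.
move=> n0 cov; apply: vol_le => -[ch p]; apply/orbit_ball_cardP.
have V0 : (0 < V)%N.
  case: ch => -[//|t ch] _.
  apply: (covered_gt0 (cov (label t) (source t))).
  by exists 1; [exact: word_ball1 | exact: erefl].
apply: covered_sub (covered_image (fun q => (ch, q))
  (covered_nearby (val ch) p cov)); last by nia.
move=> _ [x /word_ball_union[w [wn wS ->]] <-].
rewrite (action_eval A_phi) run_chain.
exists (run (step a (val ch)) p w) => //.
exact: (nearby_run _ (chainP ch)).
Qed.

End ChainSpace.

Theorem class_C_presented (f : nat -> nat) :
  (forall i, class_C f (G i)) -> class_C (fun n => (n * f n)%N) H.
Proof.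
move=> /fin_all_exists[S SP].
have symS i : symmetric_set (S i) by case: (SP i).
have genS i : generating_set (S i) by case: (SP i).
have /fin_all_exists[X XP] : forall i, exists X : Type,
    exists a : action (G i) X, faithful a /\ growth_le (vol (S i) a) f.
  by move=> i; case: (SP i).
have /fin_all_exists[a aP] := XP.
have fa i : faithful (a i) by case: (aP i).
have [K K0 cov] := uniform_growth (fun i => (aP i).2).
pose b := sum_action a.
have [A A_phi] := presented_univ phiP (@chain_action_comm _ b).
exists (union_gens S); split.
- exact: union_gens_symmetric.
- exact: union_gens_generating.
exists _, A; split.
  by apply: chain_faithful A_phi _ => i; exact: sum_action_faithful.
exists (10 * K)%N; first by rewrite muln_gt0.
move=> n n0.
have covb i u := covered_sum_action (fun i x => cov n i x n0) i u.
apply: leq_trans (chain_growth A_phi n0 covb) _.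
have -> : (10 * n * (K * f (10 * K * n)%N) = 10 * K * (n * f (10 * K * n)%N))%N by lia.
by rewrite leq_mul2l leq_mul2r [X in (_ <= X)%N]mulnC leq_pmulr ?muln_gt0 ?orbT.
Qed.

End Product.

(** * Free products and graph products extend actions *)

Section FreeProductAction.
Variables (I : choiceType) (G : I -> groupType).

Lemma fp_injM i (g h : G i) : fp_inj (g * h) = fp_inj g * fp_inj h.
Proof.
rewrite [RHS]fp_mulE; apply/fp_classP; apply: wc_sym; exact: wc_mul.
Qed.

Lemma fp_class_eval w : fp_class w = eval (@fp_inj I G) (rev w).
Proof.
elim: w => [//|[i g] w IHw].
by rewrite rev_cons eval_rcons -IHw [RHS]fp_mulE.
Qed.

Section Extend.
Variables (X : Type) (a : forall i, action (G i) X).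

Definition word_act (w : word G) (x : X) : X :=
  foldr (fun l => a (tag l) (tagged l)) x w.

Lemma word_act_cat u v x : word_act (u ++ v) x = word_act u (word_act v x).
Proof. exact: foldr_cat. Qed.

Lemma word_act_cong u v : word_cong u v -> word_act u =1 word_act v.
Proof.
elim=> {u v} [//|u v _ uv x|u v w _ uv _ vw x|u u' v v' _ uu _ vv x|i x|i g h x].
- by rewrite uv.
- by rewrite uv.
- by rewrite !word_act_cat vv uu.
- exact: act1.
- by rewrite /= actM.
Qed.

Definition fp_act (x : free_product G) : X -> X := word_act (fp_repr x).

Lemma fp_act_class w : fp_act (fp_class w) =1 word_act w.
Proof. exact: word_act_cong (fp_repr_class w). Qed.

Lemma fp_act1 p : fp_act 1 p = p.
Proof. exact: fp_act_class. Qed.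

Lemma fp_actM x y p : fp_act (x * y) p = fp_act x (fp_act y p).
Proof. by rewrite fp_act_class word_act_cat. Qed.

Definition fp_action : action (free_product G) X := Action fp_act1 fp_actM.

Lemma fp_act_inj i (g : G i) p : fp_act (fp_inj g) p = a i g p.
Proof. exact: fp_act_class. Qed.

Section Quotient.
Variable c : rel I.
Hypothesis a_comm : forall i j (g : G i) (h : G j) x, i != j -> c i j ->
  a i g (a j h x) = a j h (a i g x).

Lemma act_inv (K : groupType) (Y : Type) (b : action K Y) g y z :
  b g y = z -> b g^-1 z = y.
Proof. by move=> <-; rewrite -actM mulVg act1. Qed.

Lemma normal_closure_act r p :
  normal_closure (@graph_relators I G c) r -> fp_action r p = p.
Proof.
move=> nr; elim: nr p => {r}
  [_ [i [j [g [h [ij cij ->]]]]]||s t _ ns _ nt|r _ nr|r s _ nr] p.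
- rewrite /commg /conjg !actM; apply/act_inv/esym/act_inv.
  rewrite /= !fp_act_inj; exact: esym (a_comm _ _ _ ij cij).
- exact: act1.
- by rewrite actM nt ns.
- exact: act_inv.
- by rewrite /conjg !actM nr; exact: act_inv.
Qed.

Definition gp_act (x : graph_product G c) : X -> X := fp_act (rq_repr x).

Lemma gp_act_class y p : gp_act (rq_class _ y) p = fp_act y p.
Proof.
have /(normal_closure_act p) := rq_repr_class (@graph_relators I G c) y.
by rewrite actM => fixp; have := act_inv fixp; rewrite invgK.
Qed.

Lemma gp_act1 p : gp_act 1 p = p.
Proof. by rewrite gp_act_class fp_act1. Qed.

Lemma gp_actM x y p : gp_act (x * y) p = gp_act x (gp_act y p).
Proof. by rewrite gp_act_class fp_actM. Qed.

Definition gp_action : action (graph_product G c) X := Action gp_act1 gp_actM.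

End Quotient.
End Extend.
End FreeProductAction.

Lemma free_product_presented (I : choiceType) (G : I -> groupType) :
  presented_by (fun _ _ => false) (@fp_inj I G).
Proof.
split=> [||x|X a _].
- exact: fp_injM.
- by [].
- by exists (rev (fp_repr x)); rewrite -fp_class_eval fp_reprK.
- by exists (fp_action a); exact: fp_act_inj.
Qed.

Definition gp_inj (I : choiceType) (G : I -> groupType) (c : rel I) i (g : G i) :
  graph_product G c := rq_class _ (fp_inj g).

(** The factors generate the graph product because they generate the free
product. *)
Lemma gp_class_eval (I : choiceType) (G : I -> groupType) (c : rel I) w :
  rq_class _ (eval (@fp_inj I G) w) = eval (@gp_inj I G c) w.
Proof.
elim/last_ind: w => [//|w l IHw].
by rewrite !eval_rcons -IHw [RHS]rq_mulE.
Qed.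

Lemma graph_product_presented (I : choiceType) (G : I -> groupType) (c : rel I) :
  presented_by c (@gp_inj I G c).
Proof.
split=> [i g h|i j g h ij cij|x|X a a_comm].
- by rewrite /gp_inj fp_injM [RHS]rq_mulE.
- rewrite /gp_inj [LHS]rq_mulE [RHS]rq_mulE; apply/esym/rq_classP.
  apply: nc_gen; exists i, j, g, h; split=> //.
  by rewrite /commg /conjg invgM !mulgA.
- exists (rev (fp_repr (rq_repr x))).
  by rewrite -gp_class_eval -fp_class_eval fp_reprK rq_reprK.
- exists (gp_action a_comm) => i g x.
  by rewrite /= gp_act_class // fp_act_inj.
Qed.

(** * Free products and graph products of groups of bounded growth *)

Theorem proposition1p2 (f : nat -> nat) (k : nat) (hk : (1 <= k)%N)
    (G : 'I_k -> groupType) (hG : forall i : 'I_k, class_C f (G i)) :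
  class_C (fun n => (n * f n)%N) (free_product G) /\
  (forall c : 'I_k -> 'I_k -> bool,
     (forall i j : 'I_k, i != j -> c i j = c j i) ->
     class_C (fun n => (n * f n)%N) (graph_product G c)).
Proof.
split=> [|c c_sym].
  exact: (@class_C_presented _ _ (fun _ _ => false) _ _ (fun _ _ _ => erefl)
    (free_product_presented G)).
exact: (class_C_presented c_sym (graph_product_presented G c) hG).
Qed.
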